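(* Let $n\ge1$, let $H\in\mathbb{R}^{n\times n}$ be symmetric positive definite with symmetric positive-definite square root $H^{1/2}$, $\delta>0$, $a\in\mathbb{R}$, $b\in\mathbb{R}^n$, and $\beta=\sqrt{b^{\mathsf T}H^{-1}b}$. Let $\mathbb B_{n+1}=\{(\xi_0,\xi)\in\mathbb{R}\times\mathbb{R}^n:\xi_0^2+\|\xi\|^2\le1\}$ and consider the robust problem $$\inf_{t\in\mathbb{R},\,z\in\mathbb{R}^n}\ at+b^{\mathsf T}z\quad\text{subject to}\quad\delta\xi_0+\xi^{\mathsf T}H^{1/2}z\le t\quad\forall(\xi_0,\xi)\in\mathbb B_{n+1}.$$ (i) If $a>\beta$, the robust problem has the unique optimal solution $t^*=\dfrac{\delta a}{\sqrt{a^2-\beta^2}}$, $z^*=-\dfrac{\delta}{\sqrt{a^2-\beta^2}}H^{-1}b$. (ii) If $a=\beta>0$, the robust problem is strictly feasible and has finite value zero, but no feasible point attains this value. (iii) If $a<\beta$, the robust objective is unbounded below on the feasible set. (iv) If $(a,b)=(0,0)$, every feasible point is optimal with value zero.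
   Context: $\|\cdot\|$ is the Euclidean norm. Strict feasibility means strict conic feasibility: the feasible set is $\{(t,z):(t,H^{1/2}z,\delta)\in\mathcal Q^{n+2}\}$ with $\mathcal Q^{n+2}=\{(y_0,\bar y)\in\mathbb{R}\times\mathbb{R}^{n+1}: y_0\ge\|\bar y\|\}$, and there is $(t,z)$ with $(t,H^{1/2}z,\delta)\in\operatorname{int}\mathcal Q^{n+2}$. *)

(* Defs.v *)
From HB Require Import structures.
From mathcomp Require Import all_boot all_order all_algebra.
From mathcomp Require Import all_classical all_reals all_analysis.

Set Implicit Arguments.
Unset Strict Implicit.
Unset Printing Implicit Defensive.

Import Order.TTheory GRing.Theory Num.Theory.
Import numFieldNormedType.Exports.

Local Open Scope classical_set_scope.
Local Open Scope ring_scope.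

Definition dotv (R : realType) (n : nat) (u v : 'cV[R]_n) : R :=
  (u^T *m v) 0 0.

(* The canonical norm on matrices is the sup norm, hence this definition. *)
Definition enorm (R : realType) (n : nat) (v : 'cV[R]_n) : R :=
  Num.sqrt (dotv v v).

Definition sym_posdef (R : realType) (n : nat) (A : 'M[R]_n) : Prop :=
  A^T = A /\ forall v : 'cV[R]_n, v != 0 -> 0 < dotv v (A *m v).

Definition posdef_sqrt (R : realType) (n : nat) (H S : 'M[R]_n) : Prop :=
  sym_posdef S /\ S *m S = H.

Definition unit_ball (R : realType) (n : nat) : set (R * 'cV[R]_n) :=
  [set xi | xi.1 ^+ 2 + enorm xi.2 ^+ 2 <= 1].

(* Second-order cone Q^{m+1}, with m the dimension of the vector part. *)
Definition soc (R : realType) (m : nat) : set (R * 'cV[R]_m) :=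
  [set y | enorm y.2 <= y.1].

Section RobustProblem.
Variables (R : realType) (n : nat).
(* S plays the role of H^{1/2}. *)
Variables (S : 'M[R]_n) (delta a : R) (b : 'cV[R]_n).

Definition objective (p : R * 'cV[R]_n) : R := a * p.1 + dotv b p.2.

Definition robust_feasible : set (R * 'cV[R]_n) :=
  [set p | forall xi, unit_ball xi ->
             delta * xi.1 + dotv xi.2 (S *m p.2) <= p.1].

Definition conic_point (p : R * 'cV[R]_n) : R * 'cV[R]_(n + 1) :=
  (p.1, col_mx (S *m p.2) delta%:M).

(* The sup-norm and product topologies on R * 'cV[R]_(n + 1) are the usual
   topology of R^{n+2}, so interior is the usual interior. *)
Definition strictly_feasible : Prop :=
  robust_feasible = [set p | soc (conic_point p)] /\
  exists p, (interior (@soc R (n + 1))) (conic_point p).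

Definition robust_optimal (p : R * 'cV[R]_n) : Prop :=
  robust_feasible p /\
  forall q, robust_feasible q -> objective p <= objective q.

Definition robust_value : \bar R :=
  ereal_inf [set (objective p)%:E | p in robust_feasible].

End RobustProblem.

(* Main.v *)
(** Writing [w = S z], [c = S H^-1 b], the feasible set is
    [{t > 0, delta^2 + |w|^2 <= t^2}], the objective is
    [a t + c . w], and [beta = |c|].  Each Cauchy-Schwarz type estimate below
    comes from expanding one nonnegative square [|u + k v|^2]. *)
Require Import Defs.
From HB Require Import structures.
From mathcomp Require Import all_boot all_order all_algebra.
From mathcomp Require Import all_classical all_reals all_analysis.
From mathcomp Require Import ring lra.

Set Implicit Arguments.
Unset Strict Implicit.
Unset Printing Implicit Defensive.

Import Order.TTheory GRing.Theory Num.Theory.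
Import numFieldNormedType.Exports.

Local Open Scope classical_set_scope.
Local Open Scope ring_scope.

(** * Dot product, Euclidean norm and the interior of the second-order cone *)

Section DotProduct.
Variables (R : realType) (n : nat).
Implicit Types (u v w : 'cV[R]_n) (A : 'M[R]_n).

Lemma dotvE u v : dotv u v = \sum_i u i 0 * v i 0.
Proof. by rewrite /dotv mxE; apply: eq_bigr => i _; rewrite mxE. Qed.

Lemma dotvC u v : dotv u v = dotv v u.
Proof. by rewrite !dotvE; apply: eq_bigr => i _; rewrite mulrC. Qed.

Lemma dotvDr u v w : dotv u (v + w) = dotv u v + dotv u w.
Proof. by rewrite /dotv mulmxDr mxE. Qed.

Lemma dotvZr k u v : dotv u (k *: v) = k * dotv u v.
Proof. by rewrite /dotv -scalemxAr mxE. Qed.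

Lemma dotvZl k u v : dotv (k *: u) v = k * dotv u v.
Proof. by rewrite dotvC dotvZr dotvC. Qed.

Lemma dotv0 u : dotv u 0 = 0.
Proof. by rewrite /dotv mulmx0 mxE. Qed.

Lemma dot0v u : dotv 0 u = 0.
Proof. by rewrite dotvC dotv0. Qed.

Lemma dotv_sqrD k u v :
  dotv (u + k *: v) (u + k *: v) =
  dotv u u + 2 * k * dotv u v + k ^+ 2 * dotv v v.
Proof.
rewrite dotvDr dotvZr ![dotv (u + _) _]dotvC !dotvDr !dotvZr (dotvC v u); ring.
Qed.

Lemma dotv_ge0 u : 0 <= dotv u u.
Proof. by rewrite dotvE; apply: sumr_ge0 => i _; rewrite -expr2 sqr_ge0. Qed.

Lemma dotv_eq0 u : dotv u u = 0 -> u = 0.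
Proof.
rewrite dotvE => /eqP; rewrite psumr_eq0; last first.
  by move=> i _; rewrite -expr2 sqr_ge0.
move=> /allP u0; apply/matrixP => i j; rewrite ord1 mxE.
by have := implyP (u0 i (mem_index_enum i)) isT; rewrite mulf_eq0 orbb => /eqP.
Qed.

Lemma sqr_enorm u : enorm u ^+ 2 = dotv u u.
Proof. by rewrite sqr_sqrtr // dotv_ge0. Qed.

Lemma dotv_sym A u v : A^T = A -> dotv (A *m u) v = dotv u (A *m v).
Proof. by move=> As; rewrite /dotv trmx_mul As mulmxA. Qed.

(** A singular matrix has a nonzero left kernel vector; by symmetry its transpose lies in the right
    kernel, where the quadratic form vanishes. *)
Lemma sym_posdef_unitmx A : sym_posdef A -> A \in unitmx.
Proof.
move=> [As Apos]; rewrite unitmxE unitfE; apply/negP => /det0P [v v0 vA].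
have := Apos v^T; rewrite trmx_eq0 => /(_ v0).
by rewrite -{1}As -trmx_mul vA trmx0 dotv0 ltxx.
Qed.

(** The ambient topology comes from the sup norm, so continuity is obtained from that of the
    coordinates. *)
Lemma continuous_enorm : continuous (@enorm R n).
Proof.
have -> : @enorm R n = Num.sqrt \o (fun u : 'cV[R]_n => \sum_i u i 0 * u i 0).
  by apply/funext => u; rewrite /enorm dotvE.
move=> v; apply: continuous_comp; last exact: sqrt_continuous.
apply: continuous_big => [|i _ u]; first exact: add_continuous.
have coord := @coord_continuous R n 1 i 0 u.
exact: (cvgM coord coord).
Qed.

(** The gap [x.1 - enorm x.2] is continuous in [x], so it stays positive near [y]. *)
Lemma interior_soc (y : R * 'cV[R]_n) :
  enorm y.2 < y.1 -> interior (@soc R n) y.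
Proof.
move=> yP; have yP' : 0 < y.1 - enorm y.2 by rewrite subr_gt0.
have cont : {for y, continuous (fun x : R * 'cV[R]_n => x.1 - enorm x.2)}.
  apply: cvgB; first exact: cvg_fst.
  apply: (@continuous_comp _ _ _ snd (@enorm R n)); first exact: cvg_snd.
  exact: continuous_enorm.
apply: (@filterS _ (nbhs y) _ _ _ _ (cont _ (lt_nbhsr yP'))) => x /=.
by rewrite subr_gt0 => /ltW.
Qed.

End DotProduct.

Lemma dotv_col_mx (R : realType) (m n : nat)
    (u u' : 'cV[R]_m) (v v' : 'cV[R]_n) :
  dotv (col_mx u v) (col_mx u' v') = dotv u u' + dotv v v'.
Proof. by rewrite /dotv tr_col_mx mul_row_col mxE. Qed.

(** * The robust feasible set as a slice of the second-order cone *)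

Section RobustCone.
Variables (R : realType) (n : nat) (S : 'M[R]_n) (delta : R).
Hypothesis delta_gt0 : 0 < delta.
Implicit Type p : R * 'cV[R]_n.

(** The worst case of a linear form over the unit ball is the norm of its coefficient vector, here
    [(delta, S *m p.2)]. *)
Lemma robust_feasibleP p :
  robust_feasible S delta p <->
  0 < p.1 /\ delta ^+ 2 + dotv (S *m p.2) (S *m p.2) <= p.1 ^+ 2.
Proof.
case: p => t z /=; set w := S *m z; have w0 := dotv_ge0 w.
split=> [feas|[t0 tw] [x0 x]].
- have N0 : 0 < delta ^+ 2 + dotv w w by rewrite ltr_pwDl ?exprn_gt0.
  set r := Num.sqrt (delta ^+ 2 + dotv w w).
  have r0 : 0 < r by rewrite sqrtr_gt0.
  have r2 : r ^+ 2 = delta ^+ 2 + dotv w w by rewrite sqr_sqrtr // ltW.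
  (* The normalised vector [(delta, w)] attains the worst case, with value [r]. *)
  have /feas /= : unit_ball (delta / r, r^-1 *: w).
    rewrite /unit_ball /= sqr_enorm dotvZl dotvZr.
    suff -> : (delta / r) ^+ 2 + r^-1 * (r^-1 * dotv w w) =
       (delta ^+ 2 + dotv w w) / r ^+ 2 by rewrite r2 divff ?gt_eqF.
    by field; rewrite gt_eqF.
  rewrite -/w dotvZl.
  have -> : delta * (delta / r) + r^-1 * dotv w w = r ^+ 2 / r.
    by rewrite r2; field; rewrite gt_eqF.
  rewrite expr2 mulfK ?gt_eqF // => rt; split; first exact: lt_le_trans rt.
  by rewrite -r2 ler_sqr // nnegrE ltW // (lt_le_trans r0).
- rewrite /unit_ball /= sqr_enorm -/w => ball.
  (* Expand [(delta - t x0)^2 + |w - t x|^2 >= 0]. *)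
  have := dotv_ge0 (w + (- t) *: x); rewrite dotv_sqrD (dotvC w x).
  have := sqr_ge0 (delta - t * x0).
  have t2ball : t ^+ 2 * (x0 ^+ 2 + dotv x x) <= t ^+ 2 * 1.
    by rewrite ler_pM2l // exprn_gt0.
  move=> sq1 sq2; rewrite -(ler_pM2l t0); nra.
Qed.

Lemma soc_conic_point p :
  soc (conic_point S delta p) <->
  0 < p.1 /\ delta ^+ 2 + dotv (S *m p.2) (S *m p.2) <= p.1 ^+ 2.
Proof.
case: p => t z; rewrite /soc /conic_point /= /enorm dotv_col_mx.
have -> : dotv (delta%:M : 'cV[R]_1) delta%:M = delta ^+ 2.
  by rewrite dotvE big_ord1 mxE eqxx mulr1n expr2.
set w := S *m z; have w0 := dotv_ge0 w; rewrite [X in Num.sqrt X]addrC.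
have N0 : 0 < delta ^+ 2 + dotv w w by rewrite ltr_pwDl ?exprn_gt0.
split=> [st|[t0 tw]].
- have t0 : 0 < t by apply: lt_le_trans st; rewrite sqrtr_gt0.
  split=> //; rewrite -ler_sqrt; first by rewrite sqrtr_sqr ger0_norm // ltW.
  exact/exprn_ge0/ltW.
- by rewrite -(ger0_norm (ltW t0)) -sqrtr_sqr ler_wsqrtr.
Qed.

Lemma robust_strictly_feasible : strictly_feasible S delta.
Proof.
split.
  apply/seteqP; split=> p /=.
    by move/robust_feasibleP/soc_conic_point.
  by move/soc_conic_point/robust_feasibleP.
(* At [z = 0] the vector part has norm [delta], so any larger [t] is interior. *)
exists (delta + 1, 0); apply: interior_soc => /=.
rewrite /enorm mulmx0 dotv_col_mx dotv0 add0r dotvE big_ord1 mxE eqxx mulr1n.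
by rewrite -expr2 sqrtr_sqr ger0_norm ?ltW // ltrDl.
Qed.

(** * The objective on the feasible set, according to the order of [a] and [beta] *)

Section Objective.
Variables (a beta : R) (b y : 'cV[R]_n).
Hypotheses (S_sym : S^T = S) (S_unit : S \in unitmx).
(** This encodes [y] as H^-1 b through [S] alone. *)
Hypothesis y_def : S *m (S *m y) = b.
Hypothesis beta_ge0 : 0 <= beta.
Hypothesis beta_sqr : dotv (S *m y) (S *m y) = beta ^+ 2.

Lemma objectiveE p : objective a b p = a * p.1 + dotv (S *m y) (S *m p.2).
Proof. by rewrite /objective -y_def dotv_sym. Qed.

(** This supplies the witnesses of all three regimes: for [k > 0], [w = - k c] is opposite to [c],
    the best direction for a given norm of [w]. *)
Lemma robust_feasible_ray t k :
  0 < t -> delta ^+ 2 + (k * beta) ^+ 2 <= t ^+ 2 ->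
  robust_feasible S delta (t, - k *: y).
Proof.
move=> t0 tk; apply/robust_feasibleP; split=> //=.
rewrite -scalemxAr dotvZl dotvZr beta_sqr; nra.
Qed.

Lemma objective_ray t k : objective a b (t, - k *: y) = a * t - k * beta ^+ 2.
Proof. by rewrite objectiveE /= -scalemxAr dotvZr beta_sqr mulNr. Qed.

Lemma robust_unique_optimum p :
  beta < a ->
  robust_optimal S delta a b p <->
  p = (delta * a / Num.sqrt (a ^+ 2 - beta ^+ 2),
       - (delta / Num.sqrt (a ^+ 2 - beta ^+ 2)) *: y).
Proof.
move=> ba; set kappa := Num.sqrt _.
have a0 : 0 < a by apply: le_lt_trans ba.
have d0 : 0 < a ^+ 2 - beta ^+ 2 by rewrite subr_gt0 ltr_sqr // nnegrE ltW.
have k0 : 0 < kappa by rewrite sqrtr_gt0.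
have k2 : kappa ^+ 2 = a ^+ 2 - beta ^+ 2 by rewrite sqr_sqrtr // ltW.
have kn0 : kappa != 0 by rewrite gt_eqF.
set ts := delta * a / kappa; set k := delta / kappa.
have k_gt0 : 0 < k by rewrite divr_gt0.
(* In the variables (t, w) the candidate is [k] times (a, -c), with [k] scaled so that it lies on
   the boundary of the feasible set. *)
have tsE : ts = k * a by rewrite /ts /k; field.
have dE : delta = k * kappa by rewrite /k; field.
have d2E : delta ^+ 2 = k ^+ 2 * (a ^+ 2 - beta ^+ 2) by rewrite -k2 dE; ring.
have feas_s : robust_feasible S delta (ts, - k *: y).
  apply: robust_feasible_ray; first by rewrite tsE mulr_gt0.
  by rewrite d2E tsE; nra.
have obj_s : objective a b (ts, - k *: y) = k * kappa ^+ 2.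
  by rewrite objective_ray tsE k2; ring.
(* The left-hand side is [|(delta, w) - (t / ts) (delta, w_s)|^2], where [w_s]
   is the optimal [w]; its vanishing also gives uniqueness. *)
have gap t z : robust_feasible S delta (t, z) ->
    delta ^+ 2 * (1 - t / ts) ^+ 2 +
    dotv (S *m z + (t / ts * k) *: (S *m y)) (S *m z + (t / ts * k) *: (S *m y))
    <= 2 * (t / ts) * k * (objective a b (t, z) - k * kappa ^+ 2).
  move=> /robust_feasibleP /= [t0 tw].
  rewrite dotv_sqrD objectiveE beta_sqr /= (dotvC (S *m z)).
  set l := t / ts; have tE : t = l * (k * a).
    by rewrite /l tsE; field; rewrite !gt_eqF.
  move: tw; rewrite k2 d2E tE => tw.
  (* The right side minus the left side is exactly the slack in [tw]. *)
  by lra.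
have ts0 : 0 < ts by rewrite tsE mulr_gt0.
split=> [[feas opt]|->]; last first.
  split=> // -[t z] feas; rewrite obj_s.
  have /robust_feasibleP /= [t0 _] := feas.
  have c0 : 0 < 2 * (t / ts) * k by rewrite !mulr_gt0 // invr_gt0.
  rewrite -subr_ge0 -(pmulr_rge0 _ c0); apply: le_trans (gap _ _ feas).
  by rewrite addr_ge0 ?dotv_ge0 // mulr_ge0 ?sqr_ge0.
case: p feas opt => t z feas /(_ _ feas_s); rewrite obj_s => opt.
have /robust_feasibleP /= [t0 _] := feas.
have c0 : 0 < 2 * (t / ts) * k by rewrite !mulr_gt0 // invr_gt0.
(* Optimality makes the bound nonpositive, so both squares vanish: the first gives [t = ts], the
   second gives [z] by invertibility of [S]. *)
have := le_trans (gap _ _ feas) (_ : _ <= 0).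
rewrite pmulr_rle0 // subr_le0 => /(_ opt).
set v := _ + _ *: _; have v0 := dotv_ge0 v.
have s0 : 0 <= delta ^+ 2 * (1 - t / ts) ^+ 2 by rewrite mulr_ge0 ?sqr_ge0.
move=> le0; have /eqP : delta ^+ 2 * (1 - t / ts) ^+ 2 = 0 by lra.
rewrite mulf_eq0 !expf_eq0 /= gt_eqF //= subr_eq0 => /eqP tts.
have tE : t = ts by rewrite -[t](mulfVK (lt0r_neq0 ts0)) -tts mul1r.
have /dotv_eq0 : dotv v v = 0 by lra.
rewrite /v -tts mul1r scalemxAr -mulmxDr => Sz.
have /eqP : z + k *: y = 0 by rewrite -[LHS](mulKmx S_unit) Sz mulmx0.
by rewrite addr_eq0 tE scaleNr => /eqP ->.
Qed.

(** The objective is at least [beta] times t - |w|, and [delta > 0] keeps |w| strictly below t. *)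
Lemma robust_objective_gt0 p :
  a = beta -> 0 < beta -> robust_feasible S delta p -> 0 < objective a b p.
Proof.
move=> aE b0 /robust_feasibleP [t0 tw]; rewrite objectiveE aE.
move: tw t0; set t := p.1; set w := S *m p.2 => tw t0.
have c0 : 0 < 2 * beta * t by rewrite !mulr_gt0.
(* Expand [|t c + beta w|^2 >= 0], where [c = S y]. *)
have := dotv_ge0 (t *: (S *m y) + beta *: w).
rewrite dotv_sqrD !dotvZl dotvZr beta_sqr => sq.
have bd : 0 < beta ^+ 2 * delta ^+ 2 by rewrite mulr_gt0 ?exprn_gt0.
have tw' := ler_wpM2l (sqr_ge0 beta) tw.
by rewrite -(pmulr_rgt0 _ c0); nra.
Qed.

(** The value is approached along the ray [- k *: y] as [k] tends to infinity. *)
Lemma robust_value_eq0 :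
  a = beta -> 0 < beta -> robust_value S delta a b = 0%:E.
Proof.
move=> aE b0; apply/eqP; rewrite eq_le; apply/andP; split; last first.
  apply/ereal_infP => _ [p feas <-]; rewrite lee_fin.
  exact/ltW/robust_objective_gt0.
apply/lee_addgt0Pr => e e0; rewrite add0e.
(* Since [sqrt (delta^2 + (k beta)^2) <= k beta + delta^2 / (2 k beta)], the
   point below is feasible, with objective [delta^2 / (2 k) = e]. *)
pose k := delta ^+ 2 / (2 * e).
have k0 : 0 < k by rewrite divr_gt0 ?mulr_gt0 ?exprn_gt0.
have d2 : delta ^+ 2 = 2 * k * e by rewrite /k; field; rewrite gt_eqF.
pose t := k * beta + e / beta.
have bn0 : beta != 0 by rewrite gt_eqF.
apply: (@le_trans _ _ (objective a b (t, - k *: y))%:E).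
  apply: ereal_inf_lbound; exists (t, - k *: y) => //.
  apply: robust_feasible_ray.
    by apply: addr_gt0; [exact: mulr_gt0|exact: divr_gt0].
  have -> : t ^+ 2 = delta ^+ 2 + (k * beta) ^+ 2 + (e / beta) ^+ 2.
    by rewrite d2 /t; field.
  by rewrite lerDl sqr_ge0.
rewrite lee_fin objective_ray aE /t le_eqVlt; apply/orP; left; apply/eqP.
by field.
Qed.

Lemma robust_unbounded :
  a < beta -> ~ has_lbound (objective a b @` robust_feasible S delta).
Proof.
move=> ab [m mP].
have [j [t [j0 feas objE]]] : exists j, exists t : R -> R,
    [/\ 0 < j,
        forall s, 0 < s -> robust_feasible S delta (t s, - s *: y) &
        forall s, objective a b (t s, - s *: y) = a * delta - s * j].
  (* For positive [beta], taking [t] as [delta + s * beta] gives an objective that is affine in [s]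
     with negative slope. For [beta = 0] the ray leaves [w] at 0, so [t] must grow by itself, and
     [a < 0] makes the objective fall. *)
  have [b0|b0] := ltP 0 beta.
    exists (beta * (beta - a)), (fun s => delta + s * beta); split.
    - by rewrite mulr_gt0 ?subr_gt0.
    - move=> s s0; have sb : 0 < s * beta by rewrite mulr_gt0.
      apply: robust_feasible_ray; first exact: addr_gt0.
      by have := mulr_gt0 delta_gt0 sb; lra.
    - by move=> s; rewrite objective_ray; ring.
  have be0 : beta = 0 by apply/eqP; rewrite eq_le b0.
  exists (- a), (fun s => delta + s); split.
  - by rewrite oppr_gt0 -be0.
  - move=> s s0; apply: robust_feasible_ray; first by rewrite addr_gt0.
    by have := mulr_gt0 delta_gt0 s0; rewrite be0; nra.
  - by move=> s; rewrite objective_ray be0; ring.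
(* The decrease [s * j] then exceeds [a * delta - m], which puts the objective below [m]. *)
pose s := (`|a * delta - m| + 1) / j.
have s0 : 0 < s by rewrite divr_gt0 // ltr_wpDl.
have := mP _ (imageP _ (feas _ s0)); rewrite objE /s mulfVK ?gt_eqF //.
have := ler_norm (a * delta - m); lra.
Qed.

End Objective.
End RobustCone.

Theorem corollary9p2 (R : realType) (n : nat) (n_gt0 : (0 < n)%N)
    (H S : 'M[R]_n) (H_pd : sym_posdef H) (S_sqrt : posdef_sqrt H S)
    (delta : R) (delta_gt0 : 0 < delta) (a : R) (b : 'cV[R]_n) (beta : R)
    (beta_def : beta = Num.sqrt (dotv b (invmx H *m b))) :
  [/\ (beta < a ->
       forall p : R * 'cV[R]_n,
         robust_optimal S delta a b p <->
         p = (delta * a / Num.sqrt (a ^+ 2 - beta ^+ 2),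
              - (delta / Num.sqrt (a ^+ 2 - beta ^+ 2)) *: (invmx H *m b))),
      (a = beta -> 0 < beta ->
       [/\ strictly_feasible S delta,
           robust_value S delta a b = 0%:E &
           forall p : R * 'cV[R]_n, robust_feasible S delta p ->
             objective a b p <> 0]),
      (a < beta ->
       ~ has_lbound (objective a b @` robust_feasible S delta)) &
      (a = 0 -> b = 0 ->
       forall p : R * 'cV[R]_n, robust_feasible S delta p ->
         robust_optimal S delta a b p /\ objective a b p = 0)].
Proof.
have [[S_sym S_pos] SS] := S_sqrt.
have S_unit : S \in unitmx by exact: sym_posdef_unitmx S_sqrt.1.
have H_unit := sym_posdef_unitmx H_pd.
set y := invmx H *m b.
have y_def : S *m (S *m y) = b by rewrite mulmxA SS mulKVmx.
(* This shows the radicand of [beta] to be nonnegative, so that squaring undoes [Num.sqrt]. *)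
have c_sqr : dotv b y = dotv (S *m y) (S *m y) by rewrite -{1}y_def dotv_sym.
have beta_ge0 : 0 <= beta by rewrite beta_def sqrtr_ge0.
have beta_sqr : dotv (S *m y) (S *m y) = beta ^+ 2.
  by rewrite beta_def -/y c_sqr sqr_sqrtr // dotv_ge0.
split.
- by move=> ba p; exact: robust_unique_optimum.
- move=> aE b0; split; first exact: robust_strictly_feasible.
    exact: (@robust_value_eq0 _ _ _ _ _ _ beta _ y).
  move=> p feas; apply/eqP; rewrite gt_eqF //.
  exact: (robust_objective_gt0 delta_gt0 S_sym y_def beta_sqr aE b0 feas).
- exact: (@robust_unbounded _ _ _ _ _ _ _ _ y).
- move=> -> -> p feas.
  have obj0 q : objective 0 (0 : 'cV[R]_n) q = 0.
    by rewrite /objective mul0r dot0v addr0.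
  by split; [split=> // q _; rewrite !obj0 | exact: obj0].
Qed.
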